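(* Let $\tau$ be a set of proposition symbols, let $\varphi,\psi\in\mathrm{PL}[\tau]$, and let $(\theta,\theta',\chi)$ be an output of the global contrastive explanation problem with input $(\varphi,\psi)$, where $\theta,\theta',\chi$ are in CNF. Then: (1) each clause of $\theta$ is a weak $(\varphi,\psi)$-contrast; (2) each clause of $\theta'$ is a weak $(\psi,\varphi)$-contrast; (3) each clause of $\chi$ is a $(\varphi,\psi)$-likeness.
   Context: $\mathrm{PL}[\tau]$ is the set of propositional formulas over $\tau$ given by $\varphi ::= \bot \mid p \mid \neg\varphi \mid \varphi\land\varphi \mid \varphi\lor\varphi$ with $p\in\tau$; $\top:=\neg\bot$. $\vDash$ is classical logical consequence and $\equiv$ is logical equivalence. Size: $\mathrm{size}(\varphi)$ is the number of occurrences of proposition symbols in $\varphi$, i.e. $\mathrm{size}(\bot)=0$, $\mathrm{size}(p)=1$, $\mathrm{size}(\neg\alpha)=\mathrm{size}(\alpha)$, $\mathrm{size}(\alpha\land\beta)=\mathrm{size}(\alpha\lor\beta)=\mathrm{size}(\alpha)+\mathrm{size}(\beta)$. Literals are formulas $p$ or $\neg p$. A clause is a disjunction of (one or more) literals. A CNF formula is a conjunction of zero or more clauses (the empty conjunction being $\top$, of size $0$); the formula $\bot$ (size $0$) is also admitted as a CNF formula, having no clauses. Global contrastive explanation problem (propositional, CNF outputs). Input: $(\varphi,\psi)$. Output: a triple $(\theta,\theta',\chi)$ of CNF formulas over $\tau$ such that 1. $\theta\land\chi\equiv\varphi\land\neg\psi$ and $\theta'\land\chi\equiv\neg\varphi\land\psi$;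 2. $\mathrm{size}(\theta)+\mathrm{size}(\theta')+\mathrm{size}(\chi)$ is minimal among all triples of CNF formulas satisfying 1; 3. as a secondary optimization criterion, $\mathrm{size}(\chi)$ is maximal among the triples satisfying 1 and 2. For formulas $\alpha,\beta,\gamma$: $\gamma$ is a weak $(\alpha,\beta)$-contrast if $\alpha\land\neg\beta\vDash\gamma$ and $\neg\alpha\land\beta\nvDash\gamma$; $\gamma$ is an $(\alpha,\beta)$-likeness if $\alpha\land\neg\beta\vDash\gamma$ and $\neg\alpha\land\beta\vDash\gamma$. *)

(* Defs.v *)
From mathcomp Require Import all_boot.

Set Implicit Arguments.
Unset Strict Implicit.
Unset Printing Implicit Defensive.

Inductive PL (tau : Type) : Type :=
  | Bot : PL tau
  | Var : tau -> PL tau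
  | Neg : PL tau -> PL tau
  | And : PL tau -> PL tau -> PL tau
  | Or : PL tau -> PL tau -> PL tau.

Arguments Bot {tau}.

Definition Top {tau : Type} : PL tau := Neg Bot.

Fixpoint eval (tau : Type) (v : tau -> bool) (f : PL tau) : bool :=
  match f with
  | Bot => false
  | Var p => v p
  | Neg a => ~~ eval v a
  | And a b => eval v a && eval v b
  | Or a b => eval v a || eval v b
  end.

Definition entails (tau : Type) (a b : PL tau) : Prop :=
  forall v : tau -> bool, eval v a -> eval v b.

Definition equivalent (tau : Type) (a b : PL tau) : Prop :=
  forall v : tau -> bool, eval v a = eval v b.

Fixpoint fsize (tau : Type) (f : PL tau) : nat :=
  match f with
  | Bot => 0
  | Var _ => 1
  | Neg a => fsize a
  | And a b | Or a b => fsize a + fsize b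
  end.

Inductive is_literal (tau : Type) : PL tau -> Prop :=
  | literal_pos p : is_literal (Var p)
  | literal_neg p : is_literal (Neg (Var p)).

(* Disjunctions and conjunctions may be parenthesized in any way. *)
Inductive is_clause (tau : Type) : PL tau -> Prop :=
  | clause_literal l : is_literal l -> is_clause l
  | clause_or a b : is_clause a -> is_clause b -> is_clause (Or a b).

Inductive is_clause_conj (tau : Type) : PL tau -> Prop :=
  | conj_clause c : is_clause c -> is_clause_conj c
  | conj_and a b :
      is_clause_conj a -> is_clause_conj b -> is_clause_conj (And a b).

Inductive is_cnf (tau : Type) : PL tau -> Prop :=
  | cnf_top : is_cnf Top
  | cnf_bot : is_cnf Bot
  | cnf_conj f : is_clause_conj f -> is_cnf f.

(* A clause of a CNF formula is one of its conjuncts, not a proper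
   subdisjunction of one; [Top] and [Bot] have no clauses. *)
Inductive clause_of (tau : Type) (c : PL tau) : PL tau -> Prop :=
  | clause_of_self : is_clause c -> clause_of c c
  | clause_of_andl a b : clause_of c a -> clause_of c (And a b)
  | clause_of_andr a b : clause_of c b -> clause_of c (And a b).

Definition weak_contrast (tau : Type) (a b c : PL tau) : Prop :=
  entails (And a (Neg b)) c /\ ~ entails (And (Neg a) b) c.

Definition likeness (tau : Type) (a b c : PL tau) : Prop :=
  entails (And a (Neg b)) c /\ entails (And (Neg a) b) c.

Definition separates (tau : Type) (phi psi theta theta' chi : PL tau) : Prop :=
  [/\ is_cnf theta, is_cnf theta', is_cnf chi,
      equivalent (And theta chi) (And phi (Neg psi))
    & equivalent (And theta' chi) (And (Neg phi) psi)].

Definition min_separates (tau : Type) (phi psi theta theta' chi : PL tau) :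
    Prop :=
  separates phi psi theta theta' chi /\
  forall eta eta' xi : PL tau, separates phi psi eta eta' xi ->
    fsize theta + fsize theta' + fsize chi
      <= fsize eta + fsize eta' + fsize xi.

Definition global_contrastive_explanation (tau : Type)
    (phi psi theta theta' chi : PL tau) : Prop :=
  min_separates phi psi theta theta' chi /\
  forall eta eta' xi : PL tau, min_separates phi psi eta eta' xi ->
    fsize xi <= fsize chi.

(* Main.v *)
(** Both targets entail every clause of [chi], and the target of [theta] entails
    every clause of [theta]. If the other target also entailed a clause [c] of
    [theta], then moving [c] from [theta] to [chi] would preserve the two
    equivalences without raising the total size, while making [chi] longer. *)
Require Import Defs.
From mathcomp Require Import all_boot zify.

Set Implicit Arguments.
Unset Strict Implicit.
Unset Printing Implicit Defensive.

(** A clause contains at least one literal. This makes the growth of [chi] strict when a clause is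
    moved into it. *)
Lemma is_clause_size_gt0 (tau : Type) (c : PL tau) :
  is_clause c -> 0 < fsize c.
Proof. by elim=> [l [] //|a b _ Ha _ _ /=]; rewrite addn_gt0 Ha. Qed.

Lemma clause_of_is_clause (tau : Type) (c f : PL tau) :
  clause_of c f -> is_clause c.
Proof. by elim. Qed.

Lemma clause_of_entails (tau : Type) (c f : PL tau) :
  clause_of c f -> entails f c.
Proof.
by elim=> [_ v //|a b _ IH|a b _ IH] v /= /andP[Ha Hb]; exact: IH.
Qed.

(** Neither a literal nor a clause has [And] at its head, so only [conj_and] can have built the
    conjunction. *)
Lemma is_cnf_And_inv (tau : Type) (a b : PL tau) :
  is_cnf (And a b) -> is_cnf a /\ is_cnf b.
Proof.
move=> H; inversion H as [| |f Hf]; subst.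
inversion Hf as [c Hc|a' b' Ha Hb]; subst; last by split; apply: cnf_conj.
by inversion Hc as [l Hl|]; subst; inversion Hl.
Qed.

(* [And] itself does not preserve [is_cnf]: [Top] and [Bot] are not clauses. *)
Lemma is_cnf_conj_exists (tau : Type) (a b : PL tau) :
  is_cnf a -> is_cnf b ->
  exists g, [/\ is_cnf g, equivalent g (And a b)
                & fsize g <= fsize a + fsize b].
Proof.
case=> [||f Hf] Hb.
- by exists b; split.
- by exists Bot; split=> //; apply: cnf_bot.
case: Hb => [||g Hg].
- exists f; split=> [|v|]; [exact: cnf_conj|by rewrite /= andbT|exact: leq_addr].
- by exists Bot; split=> [|v|] //; [apply: cnf_bot|rewrite /= andbF].
- by exists (And f g); split=> //; apply: cnf_conj; apply: conj_and.
Qed.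

(** Induction on the position of [c]: a lone clause leaves [Top], and at an [And] the remainder of
    one side is rejoined with the other side, where a [Top] must be absorbed to stay in CNF. *)
Lemma clause_of_remove (tau : Type) (c f : PL tau) :
  clause_of c f -> is_cnf f ->
  exists g, [/\ is_cnf g, equivalent (And g c) f
                & fsize g + fsize c <= fsize f].
Proof.
elim=> [_ _|a b _ IH /is_cnf_And_inv[Ha Hb]|a b _ IH /is_cnf_And_inv[Ha Hb]].
- by exists Top; split=> //; apply: cnf_top.
- have [g [Hg Eg Sg]] := IH Ha.
  have [h [Hh Eh Sh]] := is_cnf_conj_exists Hg Hb.
  exists h; split=> // [v|/=]; last by lia.
  by have := Eg v; rewrite /= (Eh v) /= => <-; rewrite andbAC.
- have [g [Hg Eg Sg]] := IH Hb.
  have [h [Hh Eh Sh]] := is_cnf_conj_exists Ha Hg.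
  exists h; split=> // [v|/=]; last by lia.
  by have := Eg v; rewrite /= (Eh v) /= => <-; rewrite andbA.
Qed.

Lemma separates_sym (tau : Type) (phi psi theta theta' chi : PL tau) :
  separates phi psi theta theta' chi -> separates psi phi theta' theta chi.
Proof.
by case=> Ht Ht' Hc E E'; split=> // v; [rewrite E' | rewrite E]; rewrite /= andbC.
Qed.

Lemma min_separates_sym (tau : Type) (phi psi theta theta' chi : PL tau) :
  min_separates phi psi theta theta' chi ->
  min_separates psi phi theta' theta chi.
Proof.
case=> /separates_sym Hs Hm; split=> // eta eta' xi /separates_sym /Hm.
by rewrite (addnC (fsize theta)) (addnC (fsize eta')).
Qed.

(** Swapping the two inputs swaps [theta] and [theta'], so the claim on [theta'] reduces to the one
    on [theta]. *)
Lemma global_contrastive_explanation_sym (tau : Type)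
    (phi psi theta theta' chi : PL tau) :
  global_contrastive_explanation phi psi theta theta' chi ->
  global_contrastive_explanation psi phi theta' theta chi.
Proof.
by case=> /min_separates_sym Hs Hm; split=> // eta eta' xi /min_separates_sym /Hm.
Qed.

Lemma clause_of_theta_weak_contrast (tau : Type)
    (phi psi theta theta' chi c : PL tau) :
  global_contrastive_explanation phi psi theta theta' chi ->
  clause_of c theta -> weak_contrast phi psi c.
Proof.
move=> [[[Ht Ht' Hx E E'] Hmin] Hmax] Hc; split=> [v|Hent].
  by rewrite -E /= => /andP[Hv _]; apply: (clause_of_entails Hc).
have Cc := clause_of_is_clause Hc.
have [t [Kt Et St]] := clause_of_remove Hc Ht.
have [x [Kx Ex Sx]] := is_cnf_conj_exists Hx (cnf_conj (conj_clause Cc)).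
(* On the side of [theta] the clause only changes place; on the side of [theta'] it is a new
   conjunct, harmless by [Hent]. *)
have Hsep : separates phi psi t theta' x.
  split=> // v.
    by rewrite -E /= -(Et v) (Ex v) /= -andbA (andbC (eval v c)).
  rewrite /= (Ex v) /= andbA -[X in X && _]/(eval v (And theta' chi)) E'.
  exact/andb_idr/Hent.
have Hle := Hmin _ _ _ Hsep.
(* [Sx] bounds [x] only from above. The lower bound comes from minimality: [Hle] and [St] give
   [fsize chi + fsize c <= fsize x]. *)
have Hlt : fsize chi < fsize x by have := is_clause_size_gt0 Cc; lia.
have Hx_min : min_separates phi psi t theta' x.
  by split=> // eta eta' xi /Hmin; lia.
by have := Hmax _ _ _ Hx_min; lia.
Qed.

Theorem theorem4p2 (tau : Type) (phi psi theta theta' chi : PL tau)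
  (hout : global_contrastive_explanation phi psi theta theta' chi) :
  (forall c : PL tau, clause_of c theta -> weak_contrast phi psi c) /\
  (forall c : PL tau, clause_of c theta' -> weak_contrast psi phi c) /\
  (forall c : PL tau, clause_of c chi -> likeness phi psi c).
Proof.
split=> [c|]; first exact: clause_of_theta_weak_contrast hout.
split=> c.
  exact: clause_of_theta_weak_contrast (global_contrastive_explanation_sym hout).
have [[[_ _ _ E E'] _] _] := hout.
by move=> /clause_of_entails Hc; split=> v; rewrite -?E -?E' => /andP[_ /Hc].
Qed.
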